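(* Let $q\in\mathbb C$ with $0<|q|<1$ and let $z\in\mathbb C$. For all $t\in\mathbb C$ small enough (that is, for all $t$ with $|t|<\delta$ for some $\delta>0$), the following three identities hold: $$\sum_{n=0}^\infty \mathscr Z_n(z;q)\,t^n=\frac{1}{1-t}\;{}_4\phi_5\left(\begin{array}{c} -q,\ q^{1/2},\ -q^{1/2},\ 0\\ q,\ qt^{1/2},\ -qt^{1/2},\ (qt)^{1/2},\ -(qt)^{1/2}\end{array};q,zt\right),$$ $$\sum_{n=0}^\infty \mathscr B_n(z;q)\,t^n=\frac{1}{1-t}\;{}_5\phi_5\left(\begin{array}{c} -q,\ q^{1/2},\ -q^{1/2},\ q^{(z+1)/2},\ 0\\ q,\ (qt)^{1/2},\ -(qt)^{1/2},\ qt^{1/2},\ -qt^{1/2}\end{array};q,t\right),$$ $$\sum_{n=0}^\infty \bigl(\mathscr B_n(z-2;q)-\mathscr B_n(z;q)\bigr)t^n=\frac{q^{(z-1)/2}(1+q)\,t}{(t;q)_3}\;{}_5\phi_5\left(\begin{array}{c} -q^2,\ q^{3/2},\ -q^{3/2},\ q^{(z+1)/2},\ 0\\ q^2,\ (q^3t)^{1/2},\ -(q^3t)^{1/2},\ q^2t^{1/2},\ -q^2t^{1/2}\end{array};q,qt\right).$$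
   Context: For $a\in\mathbb C$: $(a;q)_0=1$ and $(a;q)_n=(1-a)(1-aq)\cdots(1-aq^{n-1})$ for $n\ge 1$ (in particular $(0;q)_n=1$). Complex powers $q^a$ and square roots are principal values, $q^a=\exp(a\,\mathrm{Log}\,q)$. The basic hypergeometric series is $${}_r\phi_s\left(\begin{array}{c} a_1,\dots,a_r\\ b_1,\dots,b_s\end{array};q,x\right)=\sum_{k=0}^\infty\frac{(a_1;q)_k\cdots(a_r;q)_k}{(b_1;q)_k\cdots(b_s;q)_k}\left((-1)^kq^{k(k-1)/2}\right)^{1+s-r}\frac{x^k}{(q;q)_k},$$ where the $b_i$ are such that the denominators never vanish. For integers $n\ge 0$, the $q$-Bateman-$\mathscr Z$ polynomial is $$\mathscr Z_n(z;q)={}_2\phi_2\left(\begin{array}{c} q^{-n},\ q^{n+1}\\ q,\ q\end{array};q,q^nz\right),$$ and the $q$-Bateman polynomial is $$\mathscr B_n(z;q)={}_3\phi_2\left(\begin{array}{c} q^{-n},\ q^{n+1},\ q^{(1+z)/2}\\ q,\ q\end{array};q,q^n\right).$$ *)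

(* Defs.v *)
From Stdlib Require Import Reals List.
From Coquelicot Require Import Coquelicot.
Import ListNotations.

Open Scope R_scope.
Open Scope C_scope.

Definition Cexp (w : C) : C :=
  (exp (Re w) * cos (Im w), exp (Re w) * sin (Im w))%R.

(* Principal argument, in (-PI, PI] for w <> 0. *)
Definition Carg (w : C) : R :=
  if Rle_dec 0 (Im w) then acos (Re w / Cmod w) else (- acos (Re w / Cmod w))%R.

(* Principal logarithm; only meaningful for w <> 0. *)
Definition Clog (w : C) : C := (ln (Cmod w), Carg w).

(* Principal power w^a; only meaningful for w <> 0. *)
Definition Cpower (w a : C) : C := Cexp (a * Clog w).

Definition Csqrt (w : C) : C :=
  if Ceq_dec w 0 then RtoC 0 else Cpower w (1 / 2).

Fixpoint qpoch (a q : C) (n : nat) : C :=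
  match n with
  | O => 1
  | S m => qpoch a q m * (1 - a * q ^ m)
  end.

(* (a_1, ..., a_r; q)_n *)
Definition qpochs (l : list C) (q : C) (n : nat) : C :=
  fold_right (fun a p => qpoch a q n * p) (RtoC 1) l.

(* Sum of a complex series, with the junk-value convention of [Series]
   when the series of real or of imaginary parts diverges. *)
Definition CSeries (u : nat -> C) : C :=
  (Series (fun n => Re (u n)), Series (fun n => Im (u n))).

(* The exponent 1 + s - r may be negative, so u^(1+s-r) is written
   u^(1+s) / u^r; here u <> 0 as soon as q <> 0. *)
Definition phi_term (a b : list C) (q x : C) (k : nat) : C :=
  let u := (- (1)) ^ k * q ^ (k * (k - 1) / 2)%nat in
  qpochs a q k / qpochs b q k
  * (u ^ (1 + length b) / u ^ length a)
  * (x ^ k / qpoch q q k).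

Definition phi (a b : list C) (q x : C) : C := CSeries (phi_term a b q x).

(* No denominator vanishes and the series converges, so that [phi] is its
   actual sum. *)
Definition phi_wd (a b : list C) (q x : C) : Prop :=
  (forall k : nat, qpochs b q k <> 0 /\ qpoch q q k <> 0) /\
  @ex_series C_AbsRing C_NormedModule (phi_term a b q x).

Definition has_Csum (u : nat -> C) (l : C) : Prop :=
  @is_series C_AbsRing C_NormedModule u l.

Definition BatemanZ (n : nat) (z q : C) : C :=
  phi [/ q ^ n; q ^ (n + 1)] [q; q] q (q ^ n * z).

Definition BatemanB (n : nat) (z q : C) : C :=
  phi [/ q ^ n; q ^ (n + 1); Cpower q ((1 + z) / 2)] [q; q] q (q ^ n).

(* Main.v *)
Require Import Defs.
From Stdlib Require Import Reals List Lra Lia.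
From Coquelicot Require Import Coquelicot.
Import ListNotations.

Open Scope R_scope.
Open Scope C_scope.

(** The proof reorganises a double series and recognises its inner sums.

    Since [(q^-n;q)_k] vanishes for [k > n], each Bateman polynomial is a finite
    sum, and reversing the product [(q^-n;q)_k] turns it into
      [sum_(k <= n) v_k (q;q)_(n+k) / ((q;q)_(n-k) (q;q)_k^3)],
    with [u_k = (-1)^k q^(k(k-1)/2)] and [v_k = u_k^2 z^k] for [Z_n],
    [v_k = u_k (q^((1+z)/2);q)_k] for [B_n] ([BatemanZ_sum], [BatemanB_sum]).
    Multiplying by [t^n] and summing over [n = k + m], first over [m], the
    q-binomial theorem ([q_binomial]) gives
      [sum_m (q;q)_(m+2k) / (q;q)_m t^m = (q;q)_(2k) / (t;q)_(2k+1)],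
    so that every generating function is
      [sum_k v_k t^k (q;q)_(2k) / ((q;q)_k^3 (t;q)_(2k+1))]
    ([generating_function]). The interchange is legitimate because the double
    series is dominated by a product [al_k * be_m] of two convergent positive
    series ([has_Csum_diagonal]): ratios of the [(q;q)_j] are bounded above,
    uniformly in [j], by exponentials of geometric sums.

    The series so obtained is a basic hypergeometric one because a shifted
    factorial of even length splits, [(s^2;q)_(2k) = (s)_k (-s)_k (w)_k (-w)_k]
    with [w^2 = q s^2] ([qpoch_double_sqrt]). Only the squares of the chosen
    roots matter, so the branch of [Csqrt] and [Cpower] is irrelevant.

    For the third identity, [v_k] is [u_k] times a difference of two shifted
    factorials with parameters [a = q^((z-1)/2)] and [a q], and
      [(a;q)_(k+1) - (aq;q)_(k+1) = - a (1 - q^(k+1)) (aq;q)_k],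
    the term [k = 0] being zero. Thus shifting [k] by one brings out the factor
    [a (1 + q) t / (t;q)_3]. *)

(** * Complex series and summation along diagonals *)

(** Trades filters on [C] for a real limit, where squeezing and monotone
    comparison are available. *)
Lemma has_Csum_Cmod (u : nat -> C) (l : C) :
  has_Csum u l <->
  is_lim_seq (fun N => Cmod (l - sum_n u N)) 0.
Proof.
  assert (E : forall N, Cmod (l - sum_n u N) = Cmod (sum_n u N - l)).
  { intros N. rewrite <- Cmod_opp. f_equal. ring. }
  unfold has_Csum, is_series.
  rewrite (filterlim_locally_ball_norm (K := C_AbsRing) (U := C_NormedModule)).
  rewrite <- is_lim_seq_spec. unfold is_lim_seq', filterlim, filter_le, filtermap.
  split; intros H eps; specialize (H eps); revert H; apply filter_imp;
    intros N HN.
  - rewrite Rminus_0_r, Rabs_pos_eq, E by apply Cmod_ge_0. exact HN.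
  - rewrite Rminus_0_r, Rabs_pos_eq, E in HN by apply Cmod_ge_0. exact HN.
Qed.

Lemma has_Csum_ext (u v : nat -> C) (l : C) :
  (forall n, u n = v n) -> has_Csum u l -> has_Csum v l.
Proof. apply is_series_ext. Qed.

Lemma has_Csum_scal (c : C) (u : nat -> C) (l : C) :
  has_Csum u l -> has_Csum (fun n => c * u n) (c * l).
Proof. apply (is_series_scal (V := C_NormedModule)). Qed.

Lemma sum_n_Re_Im (u : nat -> C) (N : nat) :
  sum_n u N = (sum_n (fun n => Re (u n)) N, sum_n (fun n => Im (u n)) N).
Proof.
  induction N as [|N IH].
  - rewrite !sum_O. destruct (u O); reflexivity.
  - rewrite !sum_Sn, IH. reflexivity.
Qed.

Lemma CSeries_unique (u : nat -> C) (l : C) : has_Csum u l -> CSeries u = l.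
Proof.
  intros H. apply has_Csum_Cmod in H.
  assert (P : forall f : C -> R, (forall c, Rabs (f c) <= Cmod c)%R ->
    (forall N, f (l - sum_n u N)%C = f l - sum_n (fun n => f (u n)) N)%R ->
    Series (fun n => f (u n)) = f l).
  { intros f Hf Hs. apply is_series_unique.
    assert (Z : is_lim_seq (fun N => f (l - sum_n u N)%C) 0).
    { apply is_lim_seq_abs_0.
      apply (is_lim_seq_le_le (fun _ => 0%R) _ (fun N => Cmod (l - sum_n u N))).
      - intros N. split; [apply Rabs_pos|apply Hf].
      - apply is_lim_seq_const.
      - exact H. }
    pose proof (is_lim_seq_minus' _ _ _ _ (is_lim_seq_const (f l)) Z) as D.
    rewrite Rminus_0_r in D. revert D. apply is_lim_seq_ext.
    intros N. rewrite Hs.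
    set (s := sum_n (fun n => f (u n)) N).
    change (f l - (f l - s) = s)%R. ring. }
  unfold CSeries. rewrite (P Re), (P Im).
  - destruct l; reflexivity.
  - intros c. eapply Rle_trans; [|apply Rmax_Cmod]. apply Rmax_r.
  - intros N. rewrite sum_n_Re_Im. reflexivity.
  - apply re_le_Cmod.
  - intros N. rewrite sum_n_Re_Im. reflexivity.
Qed.

Lemma has_Csum_finite (u : nat -> C) (n : nat) :
  (forall k, (n < k)%nat -> u k = 0) -> has_Csum u (sum_n u n).
Proof.
  intros H.
  assert (E : forall d, sum_n u (n + d) = sum_n u n).
  { induction d as [|d IH].
    - now rewrite Nat.add_0_r.
    - rewrite Nat.add_succ_r, sum_Sn, IH, H by lia. apply Cplus_0_r. }
  apply has_Csum_Cmod.
  apply (is_lim_seq_ext_loc (fun _ => 0%R)); [|apply is_lim_seq_const].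
  exists n. intros N HN. replace N with (n + (N - n))%nat by lia.
  rewrite E. unfold Cminus. rewrite Cplus_opp_r. symmetry. apply Cmod_0.
Qed.

Lemma Cmod_sum_n_le (u : nat -> C) (v : nat -> R) (N : nat) :
  (forall n, (n <= N)%nat -> Cmod (u n) <= v n)%R ->
  (Cmod (sum_n u N) <= sum_n v N)%R.
Proof.
  induction N as [|N IH]; intros H.
  - rewrite !sum_O. now apply H.
  - rewrite !sum_Sn. eapply Rle_trans; [apply Cmod_triangle|].
    apply Rplus_le_compat; [apply IH; intros; apply H; lia|now apply H].
Qed.

(** Remainders inherit the domination: pass to the limit in the bound on the
    difference of two partial sums. *)
Lemma Cmod_tail_le (u : nat -> C) (v : nat -> R) (l : C) (s : R) (N : nat) :
  (forall n, Cmod (u n) <= v n)%R -> has_Csum u l -> is_series v s ->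
  (Cmod (l - sum_n u N) <= s - sum_n v N)%R.
Proof.
  intros Huv Hu Hv. apply has_Csum_Cmod in Hu.
  assert (B : forall d,
    (Cmod (sum_n u (N + d) - sum_n u N) <= sum_n v (N + d) - sum_n v N)%R).
  { induction d as [|d IH].
    - rewrite Nat.add_0_r. unfold Cminus. rewrite Cplus_opp_r, Cmod_0. lra.
    - rewrite Nat.add_succ_r, !sum_Sn.
      change (Cmod (sum_n u (N + d) + u (S (N + d)) - sum_n u N)
        <= sum_n v (N + d) + v (S (N + d)) - sum_n v N)%R.
      replace (sum_n u (N + d) + u (S (N + d)) - sum_n u N)
        with ((sum_n u (N + d) - sum_n u N) + u (S (N + d))) by ring.
      eapply Rle_trans; [apply Cmod_triangle|].
      specialize (Huv (S (N + d))). lra. }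
  assert (L : is_lim_seq
    (fun M => Cmod (l - sum_n u M) + (sum_n v M - sum_n v N))%R
    (0 + (s - sum_n v N))%R).
  { apply is_lim_seq_plus'; [exact Hu|].
    apply is_lim_seq_minus'; [exact Hv|apply is_lim_seq_const]. }
  rewrite Rplus_0_l in L.
  refine (is_lim_seq_le_loc (fun _ => Cmod (l - sum_n u N)) _
    (Finite (Cmod (l - sum_n u N))) (Finite _) _ (is_lim_seq_const _) L).
  exists N. intros M HM. replace M with (N + (M - N))%nat by lia.
  specialize (B (M - N)%nat).
  replace (l - sum_n u N) with
    ((l - sum_n u (N + (M - N))) + (sum_n u (N + (M - N)) - sum_n u N)) by ring.
  eapply Rle_trans; [apply Cmod_triangle|]. lra.
Qed.

Lemma sum_n_diagonal {G : AbelianMonoid} (f : nat -> nat -> G) (N : nat) :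
  sum_n (fun n => sum_n (fun k => f k (n - k)%nat) n) N
  = sum_n (fun k => sum_n (f k) (N - k)) N.
Proof.
  induction N as [|N IH].
  - now rewrite !sum_O.
  - rewrite sum_Sn, IH, !(sum_Sn _ N), Nat.sub_diag, sum_O, plus_assoc.
    f_equal. rewrite <- sum_n_plus. apply sum_n_ext_loc. intros k Hk.
    rewrite Nat.sub_succ_l by lia. now rewrite sum_Sn.
Qed.

Lemma sum_n_Rmult_l (c : R) (u : nat -> R) (N : nat) :
  sum_n (fun m => c * u m)%R N = (c * sum_n u N)%R.
Proof. exact (sum_n_m_mult_l (K := R_Ring) c u 0 N). Qed.

Lemma sum_n_Rminus (u v : nat -> R) (N : nat) :
  sum_n (fun n => u n - v n)%R N = (sum_n u N - sum_n v N)%R.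
Proof.
  induction N as [|N IH].
  - now rewrite !sum_O.
  - rewrite !sum_Sn, IH. unfold plus; simpl. ring.
Qed.

Lemma sum_n_Cminus (u v : nat -> C) (N : nat) :
  sum_n (fun n => u n - v n) N = sum_n u N - sum_n v N.
Proof.
  induction N as [|N IH].
  - now rewrite !sum_O.
  - rewrite !sum_Sn, IH. unfold plus; simpl. ring.
Qed.

(** Fubini along the diagonals [k + m = n]. The diagonal partial sum up to [N]
    differs from [sum_(k <= N) G k] by at most [sum_(k <= N) al k * r_(N-k)],
    where [r] are the remainders of [sum be]. With [A] and [B] the sums of [al]
    and [be], this is [B] times the partial sum of [al], minus the partial sum of the Cauchy
    product, hence tends to [A * B - A * B = 0] by the real theorem on Cauchy
    products. *)
Lemma has_Csum_diagonal (f : nat -> nat -> C) (G : nat -> C)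
    (al be : nat -> R) :
  (forall k, 0 <= al k)%R -> (forall m, 0 <= be m)%R ->
  ex_series al -> ex_series be ->
  (forall k m, Cmod (f k m) <= al k * be m)%R ->
  (forall k, has_Csum (f k) (G k)) ->
  exists L : C, has_Csum G L /\
    has_Csum (fun n => sum_n (fun k => f k (n - k)%nat) n) L.
Proof.
  intros Ha Hb [A HA] [B HB] Hf HG.
  assert (Tail : forall k N,
    (Cmod (G k - sum_n (f k) N) <= al k * (B - sum_n be N))%R).
  { intros k N.
    replace (al k * (B - sum_n be N))%R
      with (al k * B - sum_n (fun m => al k * be m) N)%R.
    - apply Cmod_tail_le; [apply Hf|apply HG|].
      apply (is_series_scal (V := R_NormedModule)), HB.
    - rewrite sum_n_Rmult_l. ring. }
  assert (GB : forall k, (Cmod (G k) <= al k * B)%R).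
  { intros k. replace (G k) with (G k - 0) by ring.
    replace (al k * B)%R with (al k * B - 0)%R by ring.
    assert (H : has_Csum (fun m => f k m) (G k)) by apply HG.
    apply has_Csum_Cmod in H.
    assert (L : is_lim_seq (fun N => Cmod (G k - sum_n (f k) N)
      + al k * sum_n be N)%R (0 + al k * B)%R).
    { apply is_lim_seq_plus'; [exact H|].
      apply (is_lim_seq_scal_l _ (al k) B), HB. }
    rewrite Rplus_0_l in L. rewrite Rminus_0_r.
    refine (is_lim_seq_le (fun _ => Cmod (G k - 0)) _
      (Finite (Cmod (G k - 0))) (Finite _) _ (is_lim_seq_const _) L).
    intros N. replace (G k - 0) with
      ((G k - sum_n (f k) N) + sum_n (f k) N) by ring.
    eapply Rle_trans; [apply Cmod_triangle|].
    apply Rplus_le_compat_l.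
    eapply Rle_trans; [apply Cmod_sum_n_le; intros m _; apply Hf|].
    rewrite sum_n_Rmult_l. apply Rle_refl. }
  assert (exists L, has_Csum G L) as [L HL].
  { apply (ex_series_le (V := C_CompleteNormedModule) G (fun k => al k * B)%R).
    - exact GB.
    - apply (ex_series_ext (fun k => scal B (al k))).
      + intros k. apply Rmult_comm.
      + apply (ex_series_scal (V := R_NormedModule)). now exists A. }
  exists L. split; [exact HL|].
  apply has_Csum_Cmod. apply has_Csum_Cmod in HL.
  assert (AbsEx : forall (a : nat -> R) l, (forall n, 0 <= a n)%R ->
    is_series a l -> ex_series (fun n => Rabs (a n))).
  { intros a l Hp Hs. exists l. revert Hs. apply is_series_ext.
    intros n. now rewrite Rabs_pos_eq. }
  pose proof (is_series_mult al be A B HA HB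
    (AbsEx _ _ Ha HA) (AbsEx _ _ Hb HB)) as Cauchy.
  assert (Gap : is_lim_seq (fun N => sum_n al N * B
      - sum_n (fun n => sum_f_R0 (fun k => al k * be (n - k)%nat) n) N)%R 0).
  { replace 0%R with (A * B - A * B)%R by ring.
    apply is_lim_seq_minus'; [|exact Cauchy].
    apply is_lim_seq_mult'; [exact HA|apply is_lim_seq_const]. }
  assert (Tot : is_lim_seq (fun N => Cmod (L - sum_n G N)
    + (sum_n al N * B
      - sum_n (fun n => sum_f_R0 (fun k => al k * be (n - k)%nat) n) N))%R
      (0 + 0)%R) by now apply is_lim_seq_plus'.
  rewrite Rplus_0_r in Tot.
  refine (is_lim_seq_le_le (fun _ => 0%R) _ _ 0 _ (is_lim_seq_const 0) Tot).
  intros N. split; [apply Cmod_ge_0|].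
  rewrite sum_n_diagonal.
  set (S := sum_n (fun k => sum_n (f k) (N - k)) N).
  replace (L - S) with ((L - sum_n G N) + (sum_n G N - S)) by ring.
  eapply Rle_trans; [apply Cmod_triangle|]. apply Rplus_le_compat_l.
  rewrite (sum_n_ext (fun n => sum_f_R0 _ n)
    (fun n => sum_n (fun k => al k * be (n - k)%nat)%R n))
    by (intros n; now rewrite sum_n_Reals).
  rewrite (sum_n_diagonal (fun k m => al k * be m)%R).
  assert (E1 : sum_n G N - S
    = sum_n (fun k => G k - sum_n (f k) (N - k)) N).
  { unfold S. symmetry. apply sum_n_Cminus. }
  assert (E2 : (sum_n al N * B
      - sum_n (fun k => sum_n (fun m => al k * be m) (N - k)) N)%R
    = sum_n (fun k => al k * (B - sum_n be (N - k)))%R N).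
  { rewrite (sum_n_ext (fun k => sum_n _ (N - k))
      (fun k => al k * sum_n be (N - k))%R)
      by (intros k; apply sum_n_Rmult_l).
    rewrite Rmult_comm, <- sum_n_Rmult_l, <- sum_n_Rminus.
    apply sum_n_ext. intros k.
    change (B * al k - al k * sum_n be (N - k) = al k * (B - sum_n be (N - k)))%R.
    ring. }
  rewrite E1, E2. apply Cmod_sum_n_le. intros k _. apply Tail.
Qed.

(** * q-shifted factorials *)

Lemma Cmult_cancel_r (c a b : C) : c <> 0 -> a * c = b * c -> a = b.
Proof.
  intros Hc E. replace a with (a * c * / c) by (field; exact Hc).
  rewrite E. field. exact Hc.
Qed.

Lemma one_minus_neq_0 (a : C) : (Cmod a < 1)%R -> 1 - a <> 0.
Proof.
  intros H E. assert (a = 1) as -> by (rewrite <- (Cplus_0_r a), <- E; ring).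
  rewrite Cmod_1 in H. lra.
Qed.

Lemma pow_le_one (r : R) (n : nat) : (0 <= r <= 1)%R -> (r ^ n <= 1)%R.
Proof. intros H. rewrite <- (pow1 n). now apply pow_incr. Qed.

Lemma Cmod_mult_pow_le (a q : C) (n : nat) :
  (Cmod q < 1)%R -> (Cmod (a * q ^ n) <= Cmod a)%R.
Proof.
  intros Hq. rewrite Cmod_mult, Cmod_pow. rewrite <- (Rmult_1_r (Cmod a)) at 2.
  apply Rmult_le_compat_l; [apply Cmod_ge_0|].
  apply pow_le_one. pose proof (Cmod_ge_0 q). lra.
Qed.

Lemma qpoch_neq_0 (a q : C) (n : nat) :
  (Cmod a < 1)%R -> (Cmod q < 1)%R -> qpoch a q n <> 0.
Proof.
  intros Ha Hq. induction n as [|n IH]; simpl.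
  - apply C1_nz.
  - apply Cmult_neq_0; [exact IH|]. apply one_minus_neq_0.
    eapply Rle_lt_trans; [now apply Cmod_mult_pow_le|exact Ha].
Qed.

Lemma qpoch_add (a q : C) (m n : nat) :
  qpoch a q (m + n) = qpoch a q m * qpoch (a * q ^ m) q n.
Proof.
  induction n as [|n IH].
  - rewrite Nat.add_0_r. simpl. ring.
  - rewrite Nat.add_succ_r. simpl. rewrite IH, Cpow_add_r. ring.
Qed.

Lemma qpoch_0 (q : C) (n : nat) : qpoch 0 q n = 1.
Proof. induction n as [|n IH]; simpl; [|rewrite IH]; ring. Qed.

Lemma qpoch_sqr (s q : C) (n : nat) :
  qpoch s q n * qpoch (- s) q n = qpoch (s * s) (q * q) n.
Proof.
  induction n as [|n IH]; simpl; [ring|].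
  rewrite <- IH, Cpow_mult_l. ring.
Qed.

(** Separates the factors with even exponent of [q] from those with odd
    exponent. *)
Lemma qpoch_double (a q : C) (n : nat) :
  qpoch a q (2 * n) = qpoch a (q * q) n * qpoch (a * q) (q * q) n.
Proof.
  induction n as [|n IH]; [simpl; ring|].
  replace (2 * S n)%nat with (S (S (2 * n))) by lia.
  change (qpoch a q (S (S (2 * n)))) with
    (qpoch a q (2 * n) * (1 - a * q ^ (2 * n)) * (1 - a * q ^ (S (2 * n)))).
  rewrite IH. simpl qpoch. rewrite Cpow_S, Cpow_mult_r.
  replace (q ^ 2) with (q * q) by (simpl; ring). ring.
Qed.

Lemma qpoch_double_sqrt (s w q : C) (n : nat) :
  w * w = s * s * q ->
  qpoch s q n * qpoch (- s) q n * (qpoch w q n * qpoch (- w) q n)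
  = qpoch (s * s) q (2 * n).
Proof. intros E. now rewrite !qpoch_sqr, qpoch_double, E. Qed.

Lemma qpoch_shift (a q : C) (n : nat) :
  (1 - a) * qpoch (a * q) q n = qpoch a q n * (1 - a * q ^ n).
Proof.
  pose proof (qpoch_add a q 1 n) as H. simpl in H.
  rewrite Cmult_1_l, !Cmult_1_r in H. now rewrite H.
Qed.

Lemma binom2_S (k : nat) : (S k * (S k - 1) / 2 = k * (k - 1) / 2 + k)%nat.
Proof.
  replace (S k * (S k - 1))%nat with (k * (k - 1) + k * 2)%nat by nia.
  now rewrite Nat.div_add.
Qed.

(** The twist [(-1)^k q^(k choose 2)] raised to the power [1 + s - r] in the
    definition of a basic hypergeometric series. *)
Definition sgnq (q : C) (k : nat) : C := (- (1)) ^ k * q ^ (k * (k - 1) / 2)%nat.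

Lemma sgnq_S (q : C) (k : nat) : sgnq q (S k) = - (sgnq q k * q ^ k).
Proof. unfold sgnq. rewrite binom2_S, Cpow_add_r, Cpow_S. ring. Qed.

Lemma sgnq_neq_0 (q : C) (k : nat) : q <> 0 -> sgnq q k <> 0.
Proof.
  intros H. apply Cmult_neq_0; apply Cpow_nz; [|exact H].
  intros E. pose proof Cmod_m1 as M. rewrite E, Cmod_0 in M. lra.
Qed.

Lemma Cmod_sgnq_le (q : C) (k : nat) :
  (Cmod q < 1)%R -> (Cmod (sgnq q k) <= 1)%R.
Proof.
  intros H. unfold sgnq. rewrite Cmod_mult, !Cmod_pow, Cmod_m1, pow1, Rmult_1_l.
  apply pow_le_one. pose proof (Cmod_ge_0 q). lra.
Qed.

Lemma qpoch_inv_pow_gt (q : C) (n k : nat) :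
  q <> 0 -> (n < k)%nat -> qpoch (/ q ^ n) q k = 0.
Proof.
  intros Hq H. replace k with (S n + (k - S n))%nat by lia.
  rewrite qpoch_add. simpl. rewrite Cinv_l by now apply Cpow_nz. ring.
Qed.

(** Each factor [1 - q^(k-n)] is [- q^(k-n) (1 - q^(n-k))]: pulling out the powers
    of [q] leaves the last [k] factors of [(q;q)_n]. *)
Lemma qpoch_inv_pow (q : C) (n k : nat) :
  q <> 0 -> (k <= n)%nat ->
  qpoch (/ q ^ n) q k * (q ^ n) ^ k * qpoch q q (n - k)
  = sgnq q k * qpoch q q n.
Proof.
  intros Hq. induction k as [|k IH]; intros Hk.
  - rewrite Nat.sub_0_r. unfold sgnq. simpl. ring.
  - rewrite sgnq_S.
    transitivity (- (sgnq q k * qpoch q q n) * q ^ k); [|ring].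
    rewrite <- IH by lia.
    replace (n - k)%nat with (S (n - S k)) by lia. simpl qpoch.
    rewrite (Cpow_S (q ^ n)).
    set (A := qpoch (/ q ^ n) q k). set (B := (q ^ n) ^ k).
    replace (q ^ n) with (q ^ k * (q * q ^ (n - S k)))
      by (rewrite <- Cpow_S, <- Cpow_add_r; f_equal; lia).
    assert (q ^ k <> 0) by now apply Cpow_nz.
    assert (q ^ (n - S k) <> 0) by now apply Cpow_nz.
    field. auto.
Qed.

Lemma qpoch_inv_pow_pair (q : C) (n k : nat) :
  q <> 0 -> (Cmod q < 1)%R -> (k <= n)%nat ->
  qpoch (/ q ^ n) q k * qpoch (q ^ (n + 1)) q k * (q ^ n) ^ k
  = sgnq q k * qpoch q q (n + k) / qpoch q q (n - k).
Proof.
  intros Hq Hq1 Hk.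
  pose proof (qpoch_neq_0 q q (n - k) Hq1 Hq1).
  apply (Cmult_cancel_r (qpoch q q (n - k))); [assumption|].
  transitivity (qpoch (q ^ (n + 1)) q k
    * (qpoch (/ q ^ n) q k * (q ^ n) ^ k * qpoch q q (n - k))); [ring|].
  rewrite qpoch_inv_pow, (qpoch_add q q n k) by assumption.
  replace (q ^ (n + 1)) with (q * q ^ n) by (rewrite Nat.add_1_r; reflexivity).
  field. assumption.
Qed.

(** * Uniform bounds *)

(** The bounds below are products of [1 + c r^j <= exp (c r^j)]; keeping the
    partial geometric sum in the exponent makes their induction go through. *)
Lemma geom_step (c r : R) (n : nat) : r <> 1%R ->
  (exp (c * (1 - r ^ S n) / (1 - r))
   = exp (c * (1 - r ^ n) / (1 - r)) * exp (c * r ^ n))%R.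
Proof. intros H. rewrite <- exp_plus. f_equal. simpl. field. lra. Qed.

Lemma geom_le (c r : R) (n : nat) : (0 <= c)%R -> (0 <= r < 1)%R ->
  (exp (c * (1 - r ^ n) / (1 - r)) <= exp (c / (1 - r)))%R.
Proof.
  intros Hc Hr. pose proof (pow_le r n (proj1 Hr)).
  assert (0 < / (1 - r))%R by (apply Rinv_0_lt_compat; lra).
  destruct (Rle_lt_or_eq_dec (c * (1 - r ^ n) / (1 - r)) (c / (1 - r))) as [h|h].
  - unfold Rdiv. apply Rmult_le_compat_r; [lra|].
    rewrite <- (Rmult_1_r c) at 2. apply Rmult_le_compat_l; lra.
  - left. now apply exp_increasing.
  - rewrite h. apply Rle_refl.
Qed.

Lemma exp_ineq1_weak (x : R) : (1 + x <= exp x)%R.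
Proof.
  destruct (Req_dec x 0) as [->|H]; [rewrite exp_0; lra|].
  left. now apply exp_ineq1.
Qed.

Lemma Cmod_qpoch_le (a q : C) (n : nat) : (Cmod q < 1)%R ->
  (Cmod (qpoch a q n) <= exp (Cmod a / (1 - Cmod q)))%R.
Proof.
  intros Hq. pose proof (Cmod_ge_0 q) as Hq0. pose proof (Cmod_ge_0 a) as Ha.
  eapply Rle_trans; [|apply (geom_le _ _ n Ha); lra].
  induction n as [|n IH].
  - simpl. rewrite Cmod_1, Rminus_diag, Rmult_0_r, Rdiv_0_l, exp_0. lra.
  - rewrite geom_step by lra. simpl qpoch. rewrite Cmod_mult.
    apply Rmult_le_compat; try apply Cmod_ge_0; [exact IH|].
    eapply Rle_trans; [apply Cmod_triangle|].
    rewrite Cmod_1, Cmod_opp, Cmod_mult, Cmod_pow. apply exp_ineq1_weak.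
Qed.

(** Uses [1 / (1 - y) <= 1 + y / (1 - |a|)] for [0 <= y <= |a|], which turns the
    inverse product into one of the same kind as in [Cmod_qpoch_le]. *)
Lemma Cmod_inv_qpoch_le (a q : C) (n : nat) :
  (Cmod a < 1)%R -> (Cmod q < 1)%R ->
  (Cmod (/ qpoch a q n) <= exp (Cmod a / (1 - Cmod a) / (1 - Cmod q)))%R.
Proof.
  intros Ha1 Hq. pose proof (Cmod_ge_0 q) as Hq0. pose proof (Cmod_ge_0 a) as Ha.
  assert (Hc : (0 <= Cmod a / (1 - Cmod a))%R)
    by (apply Rdiv_le_0_compat; lra).
  eapply Rle_trans; [|apply (geom_le _ _ n Hc); lra].
  induction n as [|n IH].
  - simpl. rewrite Rminus_diag, Rmult_0_r, Rdiv_0_l, exp_0.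
    replace (/ 1) with (RtoC 1) by field. rewrite Cmod_1. lra.
  - pose proof (Cmod_mult_pow_le a q n Hq) as Hp.
    assert (N : 1 - a * q ^ n <> 0) by (apply one_minus_neq_0; lra).
    rewrite geom_step by lra. simpl qpoch.
    pose proof (qpoch_neq_0 a q n Ha1 Hq).
    replace (/ (qpoch a q n * (1 - a * q ^ n)))
      with (/ qpoch a q n * / (1 - a * q ^ n)) by (field; auto).
    rewrite Cmod_mult.
    apply Rmult_le_compat; try apply Cmod_ge_0; [exact IH|].
    rewrite Cmod_inv by assumption.
    eapply Rle_trans; [|apply exp_ineq1_weak].
    assert (L : (1 - Cmod (a * q ^ n) <= Cmod (1 - a * q ^ n))%R).
    { pose proof (Cmod_triangle (1 - a * q ^ n) (a * q ^ n)) as T.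
      replace (1 - a * q ^ n + a * q ^ n) with (RtoC 1) in T by ring.
      rewrite Cmod_1 in T. lra. }
    replace (Cmod a / (1 - Cmod a) * Cmod q ^ n)%R
      with (Cmod (a * q ^ n) / (1 - Cmod a))%R
      by (rewrite Cmod_mult, Cmod_pow; field; lra).
    set (y := Cmod (a * q ^ n)) in *. assert (0 <= y)%R by apply Cmod_ge_0.
    apply Rle_trans with (/ (1 - y))%R; [apply Rinv_le_contravar; lra|].
    apply Rmult_le_reg_r with (1 - y)%R; [lra|].
    rewrite Rinv_l by lra.
    apply Rmult_le_reg_r with (1 - Cmod a)%R; [lra|].
    field_simplify; [|lra]. nra.
Qed.

(** * The q-binomial theorem *)

Lemma has_Csum_geom (t : C) : (Cmod t < 1)%R ->
  has_Csum (fun m => t ^ m) (/ (1 - t)).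
Proof.
  intros Ht. pose proof (one_minus_neq_0 t Ht) as N.
  apply has_Csum_Cmod.
  apply (is_lim_seq_ext (fun n => Cmod (/ (1 - t)) * Cmod t * Cmod t ^ n)%R).
  - intros n. rewrite Rmult_assoc, <- Cmod_pow, <- !Cmod_mult, <- Cpow_S.
    f_equal. induction n as [|n IH].
    + rewrite sum_O. simpl. field. exact N.
    + rewrite sum_Sn. change (/ (1 - t) * t ^ S (S n)
        = / (1 - t) - (sum_n (fun m => t ^ m) n + t ^ S n)).
      transitivity (/ (1 - t) - sum_n (fun m => t ^ m) n - t ^ S n); [|ring].
      rewrite <- IH, (Cpow_S t (S n)). field. exact N.
  - replace 0%R with (Cmod (/ (1 - t)) * Cmod t * 0)%R by ring.
    apply (is_lim_seq_scal_l _ _ 0). apply is_lim_seq_geom.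
    now rewrite Rabs_pos_eq by apply Cmod_ge_0.
Qed.

Lemma ex_series_geom_scal (c r : R) : (0 <= r < 1)%R ->
  ex_series (fun n => c * r ^ n)%R.
Proof.
  intros H. apply (ex_series_scal (V := R_NormedModule) c (fun n => r ^ n)%R).
  apply ex_series_geom. rewrite Rabs_pos_eq; lra.
Qed.

Lemma ex_Csum_le (u : nat -> C) (v : nat -> R) :
  (forall n, Cmod (u n) <= v n)%R -> ex_series v -> exists l, has_Csum u l.
Proof. exact (ex_series_le (V := C_CompleteNormedModule) u v). Qed.

Lemma has_Csum_unique (u : nat -> C) (l l' : C) :
  has_Csum u l -> has_Csum u l' -> l = l'.
Proof.
  intros H H'. now rewrite <- (CSeries_unique _ _ H), (CSeries_unique _ _ H').
Qed.

Lemma has_Csum_decr (u : nat -> C) (l : C) :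
  has_Csum (fun k => u (S k)) l -> has_Csum u (u O + l).
Proof.
  intros H. apply is_series_decr_1.
  assert (E : l = u O + l + - u O) by ring. rewrite E in H. exact H.
Qed.

Lemma has_Csum_incr (u : nat -> C) (l : C) :
  has_Csum u l -> has_Csum (fun k => u (S k)) (l - u O).
Proof.
  intros H. apply is_series_incr_1.
  assert (E : l = l - u O + u O) by ring. rewrite E in H. exact H.
Qed.

Definition qratio_bound (q : C) : R :=
  (exp (Cmod q / (1 - Cmod q)) * exp (Cmod q / (1 - Cmod q) / (1 - Cmod q)))%R.

Lemma Cmod_qratio_le (q : C) (i j : nat) : (Cmod q < 1)%R ->
  (Cmod (qpoch q q i / qpoch q q j) <= qratio_bound q)%R.
Proof.
  intros Hq. unfold Cdiv. rewrite Cmod_mult.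
  apply Rmult_le_compat; try apply Cmod_ge_0.
  - now apply Cmod_qpoch_le.
  - now apply Cmod_inv_qpoch_le.
Qed.

(** Induction on [N]. Writing [S] for the sum at rank [N + 1], q-Pascal reads
    [(1 - t q^(N+1)) S = (1 - q^(N+1)) * (sum at rank N)], coefficient by
    coefficient. *)
Lemma q_binomial (q t : C) (N : nat) : (Cmod q < 1)%R -> (Cmod t < 1)%R ->
  has_Csum (fun m => qpoch q q (m + N) / qpoch q q m * t ^ m)
    (qpoch q q N / qpoch t q (S N)).
Proof.
  intros Hq Ht. induction N as [|N IH].
  - replace (qpoch q q 0 / qpoch t q 1) with (/ (1 - t)).
    + apply (has_Csum_ext (fun m => t ^ m)); [|now apply has_Csum_geom].
      intros m. rewrite Nat.add_0_r. field. now apply qpoch_neq_0.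
    + simpl. pose proof (one_minus_neq_0 t Ht). field.
      now replace (1 - t * 1) with (1 - t) by ring.
  - assert (exists l, has_Csum
      (fun m => qpoch q q (m + S N) / qpoch q q m * t ^ m) l) as [l Hl].
    { apply (ex_Csum_le _ (fun m => qratio_bound q * Cmod t ^ m)%R).
      - intros m. rewrite Cmod_mult, Cmod_pow.
        apply Rmult_le_compat_r; [apply pow_le, Cmod_ge_0|].
        now apply Cmod_qratio_le.
      - apply ex_series_geom_scal. split; [apply Cmod_ge_0|exact Ht]. }
    assert (D : has_Csum
      (fun m => (1 - q ^ S N) * (qpoch q q (m + N) / qpoch q q m * t ^ m))
      (l - t * q ^ S N * l)).
    (* [t q^(N+1) S] as a series in [t^m] with no constant term, to be
       subtracted coefficientwise. *)
    { pose proof (has_Csum_decr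
        (fun m => match m with O => 0 | S m' =>
          t * q ^ S N * (qpoch q q (m' + S N) / qpoch q q m' * t ^ m') end)
        (t * q ^ S N * l) (has_Csum_scal _ _ _ Hl)) as Hs.
      rewrite Cplus_0_l in Hs.
      pose proof (is_series_minus _ _ _ _ Hl Hs) as Hd. revert Hd.
      apply is_series_ext. intros [|m].
      - change (qpoch q q (0 + S N) / qpoch q q 0 * t ^ 0 + - 0
          = (1 - q ^ S N) * (qpoch q q (0 + N) / qpoch q q 0 * t ^ 0)).
        simpl. field.
      - change (qpoch q q (S m + S N) / qpoch q q (S m) * t ^ S m
          + - (t * q ^ S N * (qpoch q q (m + S N) / qpoch q q m * t ^ m))
          = (1 - q ^ S N) * (qpoch q q (S m + N) / qpoch q q (S m) * t ^ S m)).
        pose proof (qpoch_neq_0 q q m Hq Hq) as N1.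
        pose proof (qpoch_neq_0 q q (S m) Hq Hq) as N2.
        replace (S m + S N)%nat with (S (S (m + N))) by lia.
        replace (S m + N)%nat with (S (m + N)) by lia.
        replace (m + S N)%nat with (S (m + N)) by lia.
        simpl in N2 |- *. rewrite Cpow_add_r.
        assert (1 - q * q ^ m <> 0).
        { intros E. apply N2. rewrite E. ring. }
        field. auto. }
    pose proof (has_Csum_unique _ _ _ D (has_Csum_scal (1 - q ^ S N) _ _ IH))
      as E.
    replace (qpoch q q (S N) / qpoch t q (S (S N))) with l; [exact Hl|].
    pose proof (qpoch_neq_0 t q (S N) Ht Hq) as N1.
    pose proof (qpoch_neq_0 t q (S (S N)) Ht Hq) as N2.
    change (qpoch t q (S (S N))) with (qpoch t q (S N) * (1 - t * q ^ S N)) in *.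
    change (qpoch q q (S N)) with (qpoch q q N * (1 - q * q ^ N)).
    rewrite <- Cpow_S.
    apply (Cmult_cancel_r (qpoch t q (S N) * (1 - t * q ^ S N))); [exact N2|].
    transitivity (qpoch t q (S N) * (l - t * q ^ S N * l)); [ring|].
    rewrite E.
    assert (1 - t * q ^ S N <> 0).
    { intros Z. apply N2. rewrite Z. ring. }
    field. auto.
Qed.

(** * The generating function of a terminating family *)

(** The part of the [k]-th term of a Bateman polynomial of degree [n] common to
    both families. *)
Definition bateman_kernel (q : C) (n k : nat) : C :=
  qpoch q q (n + k) / (qpoch q q (n - k) * qpoch q q k ^ 3).

(** Substituting [n = k + m] makes the summand
    [v k t^k / (q;q)_k^3 * ((q;q)_(m+2k) / (q;q)_m t^m)], whose sum over [m] is
    [q_binomial] at rank [2 k]. *)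
Lemma generating_function (q t : C) (v : nat -> C) (al : nat -> R) :
  (Cmod q < 1)%R -> (Cmod t < 1)%R ->
  (forall k, Cmod (v k * t ^ k) <= al k)%R -> ex_series al ->
  exists L : C,
    has_Csum (fun k => v k * t ^ k *
      (qpoch q q (2 * k) / (qpoch q q k ^ 3 * qpoch t q (S (2 * k))))) L /\
    has_Csum (fun n => sum_n (fun k => v k * bateman_kernel q n k) n * t ^ n) L.
Proof.
  intros Hq Ht Hv Hal.
  set (K := qratio_bound q).
  assert (HK : (0 <= K)%R).
  { apply Rmult_le_pos; left; apply exp_pos. }
  set (E := exp (Cmod q / (1 - Cmod q) / (1 - Cmod q))).
  assert (HE : (0 <= E)%R) by (left; apply exp_pos).
  destruct (has_Csum_diagonal
    (fun k m => v k * t ^ k / qpoch q q k ^ 3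
       * (qpoch q q (m + 2 * k) / qpoch q q m * t ^ m))
    (fun k => v k * t ^ k / qpoch q q k ^ 3
       * (qpoch q q (2 * k) / qpoch t q (S (2 * k))))
    (fun k => E ^ 3 * K * al k)%R (fun m => Cmod t ^ m)%R)
    as [L [H1 H2]].
  - intros k. apply Rmult_le_pos.
    + apply Rmult_le_pos; [now apply pow_le|exact HK].
    + eapply Rle_trans; [apply Cmod_ge_0|apply Hv].
  - intros m. apply pow_le, Cmod_ge_0.
  - exact (ex_series_scal (V := R_NormedModule) (E ^ 3 * K)%R al Hal).
  - apply ex_series_geom. now rewrite Rabs_pos_eq by apply Cmod_ge_0.
  - intros k m.
    replace (v k * t ^ k / qpoch q q k ^ 3) with
      (v k * t ^ k * (/ qpoch q q k) ^ 3)
      by (rewrite Cpow_inv by (now apply qpoch_neq_0); reflexivity).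
    rewrite !Cmod_mult, (Cmod_pow t m), (Cmod_pow _ 3), <- Rmult_assoc,
      <- Cmod_mult.
    apply Rmult_le_compat_r; [apply pow_le, Cmod_ge_0|].
    replace (E ^ 3 * K * al k)%R with (al k * E ^ 3 * K)%R by ring.
    apply Rmult_le_compat; try apply Cmod_ge_0; [| |now apply Cmod_qratio_le].
    + apply Rmult_le_pos; [apply Cmod_ge_0|apply pow_le, Cmod_ge_0].
    + apply Rmult_le_compat; [apply Cmod_ge_0|apply pow_le, Cmod_ge_0
        |apply Hv|].
      apply pow_incr. split; [apply Cmod_ge_0|now apply Cmod_inv_qpoch_le].
  - intros k. apply has_Csum_scal. now apply q_binomial.
  - exists L. split.
    + revert H1. apply has_Csum_ext. intros k.
      pose proof (qpoch_neq_0 q q k Hq Hq).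
      pose proof (qpoch_neq_0 t q (S (2 * k)) Ht Hq). field. auto.
    + revert H2. apply has_Csum_ext. intros n.
      rewrite (Cmult_comm _ (t ^ n)).
      transitivity (sum_n (fun k => t ^ n * (v k * bateman_kernel q n k)) n);
        [|exact (sum_n_m_mult_l (K := C_Ring) (t ^ n)
            (fun k => v k * bateman_kernel q n k) 0 n)].
      apply sum_n_ext_loc. intros k Hk. unfold bateman_kernel.
      replace (n - k + 2 * k)%nat with (n + k)%nat by lia.
      replace (t ^ n) with (t ^ k * t ^ (n - k))
        by (rewrite <- Cpow_add_r; f_equal; lia).
      pose proof (qpoch_neq_0 q q k Hq Hq).
      pose proof (qpoch_neq_0 q q (n - k) Hq Hq).
      match goal with |- @eq _ ?a ?b => change (@eq C a b) end.
      field. auto.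
Qed.

(** * Principal powers and square roots *)

Lemma Cexp_add (a b : C) : Cexp (a + b) = Cexp a * Cexp b.
Proof.
  unfold Cexp. rewrite re_plus, im_plus, exp_plus, cos_plus, sin_plus.
  unfold Cmult; simpl. f_equal; ring.
Qed.

Lemma Cexp_0 : Cexp 0 = 1.
Proof.
  unfold Cexp; simpl. rewrite exp_0, cos_0, sin_0, Rmult_1_r, Rmult_0_r.
  reflexivity.
Qed.

Lemma Cexp_neq_0 (a : C) : Cexp a <> 0.
Proof.
  intros E. apply C1_nz. rewrite <- Cexp_0, <- (Cplus_opp_r a), Cexp_add, E.
  ring.
Qed.

(** For a negative imaginary part, [Carg] takes the opposite of [acos], and
    [sin (acos c) = sqrt (1 - c^2)] is then minus the sine of the argument. *)
Lemma Cexp_Clog (w : C) : w <> 0 -> Cexp (Clog w) = w.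
Proof.
  intros Hw. pose proof (proj1 (Cmod_gt_0 w) Hw) as Hm.
  assert (M : (Cmod w * Cmod w = Re w * Re w + Im w * Im w)%R).
  { transitivity (Cmod w ^ 2)%R; [ring|]. rewrite Cmod2_alt. ring. }
  set (c := (Re w / Cmod w)%R).
  assert (Ec : (Cmod w * c = Re w)%R) by (unfold c; field; lra).
  assert (Hc : (-1 <= c <= 1)%R).
  { pose proof (re_le_Cmod w) as H. apply Rabs_le_between in H.
    split; apply Rmult_le_reg_l with (Cmod w); lra. }
  assert (Hs : (Cmod w * sqrt (1 - c²) = Rabs (Im w))%R).
  { rewrite <- (sqrt_square (Cmod w)) at 1 by lra.
    rewrite <- sqrt_mult by (unfold Rsqr; nra).
    rewrite <- sqrt_Rsqr_abs. f_equal.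
    unfold Rsqr.
    replace (Cmod w * Cmod w * (1 - c * c))%R
      with (Cmod w * Cmod w - (Cmod w * c) * (Cmod w * c))%R by ring.
    rewrite Ec, M. ring. }
  unfold Cexp, Clog, Carg. fold c.
  change (Re (?a, ?b)) with a. change (Im (?a, ?b)) with b.
  rewrite exp_ln by exact Hm.
  destruct (Rle_dec 0 (Im w)) as [Hi|Hi].
  - rewrite cos_acos, sin_acos, Ec, Hs, Rabs_pos_eq by assumption.
    now destruct w.
  - rewrite cos_neg, sin_neg, cos_acos, sin_acos by assumption.
    rewrite Ec, Ropp_mult_distr_r_reverse, Hs, Rabs_left, Ropp_involutive
      by lra.
    now destruct w.
Qed.

Lemma Cpower_add (q a b : C) : Cpower q (a + b) = Cpower q a * Cpower q b.
Proof. unfold Cpower. rewrite <- Cexp_add. f_equal. ring. Qed.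

Lemma Cpower_1_r (q : C) : q <> 0 -> Cpower q 1 = q.
Proof.
  intros Hq. unfold Cpower. rewrite Cmult_1_l. now apply Cexp_Clog.
Qed.

Lemma Cpower_half_sqr (q : C) : q <> 0 ->
  Cpower q (1 / 2) * Cpower q (1 / 2) = q.
Proof.
  intros Hq. rewrite <- Cpower_add.
  replace (1 / 2 + 1 / 2) with (RtoC 1) by field.
  now apply Cpower_1_r.
Qed.

Lemma Cpower_3half_sqr (q : C) : q <> 0 ->
  Cpower q (3 / 2) * Cpower q (3 / 2) = q ^ 3.
Proof.
  intros Hq. rewrite <- Cpower_add.
  replace (3 / 2 + 3 / 2) with (1 + (1 + 1)) by field.
  rewrite !Cpower_add, !Cpower_1_r by assumption. simpl. ring.
Qed.

Lemma Csqrt_sqr (w : C) : Csqrt w * Csqrt w = w.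
Proof.
  unfold Csqrt. destruct (Ceq_dec w 0) as [->|Hw]; [ring|].
  now apply Cpower_half_sqr.
Qed.

(** * Bateman polynomials as finite sums *)

(** [(q^-n;q)_k] contains the factor [1 - q^-n q^n] as soon as [k > n]. *)
Lemma phi_terminating (q x : C) (n : nat) (a b : list C) : q <> 0 ->
  phi (/ q ^ n :: a) b q x = sum_n (phi_term (/ q ^ n :: a) b q x) n.
Proof.
  intros Hq. apply CSeries_unique, has_Csum_finite. intros k Hk.
  unfold phi_term. cbn [qpochs fold_right].
  rewrite qpoch_inv_pow_gt by assumption. unfold Cdiv. ring.
Qed.

(** Since [c <> 0], convergence of the series of multiples [c * phi_term] gives
    convergence of the hypergeometric series itself. *)
Lemma phi_wd_sum (a b : list C) (q x c L : C) (F : nat -> C) :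
  has_Csum F L -> (Cmod q < 1)%R -> (forall k, qpochs b q k <> 0) ->
  c <> 0 -> (forall k, F k = c * phi_term a b q x k) ->
  phi_wd a b q x /\ L = c * phi a b q x.
Proof.
  intros HF Hq Hb Hc E.
  assert (H : has_Csum (phi_term a b q x) (/ c * L)).
  { apply (has_Csum_ext (fun k => / c * F k)).
    - intros k. rewrite E. field. exact Hc.
    - now apply has_Csum_scal. }
  split.
  - split; [|now exists (/ c * L)].
    intros k. split; [apply Hb|now apply qpoch_neq_0].
  - unfold phi. rewrite (CSeries_unique _ _ H). field. exact Hc.
Qed.

Lemma BatemanZ_sum (n : nat) (z q : C) : q <> 0 -> (Cmod q < 1)%R ->
  BatemanZ n z q
  = sum_n (fun k => sgnq q k * sgnq q k * z ^ k * bateman_kernel q n k) n.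
Proof.
  intros Hq Hq1. unfold BatemanZ. rewrite phi_terminating by assumption.
  apply sum_n_ext_loc. intros k Hk.
  unfold phi_term, bateman_kernel. fold (sgnq q k).
  cbn [qpochs fold_right length Nat.add].
  rewrite Cpow_mult_l.
  pose proof (qpoch_neq_0 q q k Hq1 Hq1).
  pose proof (qpoch_neq_0 q q (n - k) Hq1 Hq1).
  pose proof (sgnq_neq_0 q k Hq).
  match goal with |- @eq _ ?a ?b => change (@eq C a b) end.
  transitivity (qpoch (/ q ^ n) q k * qpoch (q ^ (n + 1)) q k * (q ^ n) ^ k
    * (sgnq q k * z ^ k / qpoch q q k ^ 3)); [field; auto|].
  rewrite qpoch_inv_pow_pair by assumption. field. auto.
Qed.

Lemma BatemanB_sum (n : nat) (z q : C) : q <> 0 -> (Cmod q < 1)%R ->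
  BatemanB n z q
  = sum_n (fun k => sgnq q k * qpoch (Cpower q ((1 + z) / 2)) q k
      * bateman_kernel q n k) n.
Proof.
  intros Hq Hq1. unfold BatemanB. rewrite phi_terminating by assumption.
  apply sum_n_ext_loc. intros k Hk.
  unfold phi_term, bateman_kernel. fold (sgnq q k).
  cbn [qpochs fold_right length Nat.add].
  pose proof (qpoch_neq_0 q q k Hq1 Hq1).
  pose proof (qpoch_neq_0 q q (n - k) Hq1 Hq1).
  pose proof (sgnq_neq_0 q k Hq).
  match goal with |- @eq _ ?a ?b => change (@eq C a b) end.
  transitivity (qpoch (/ q ^ n) q k * qpoch (q ^ (n + 1)) q k * (q ^ n) ^ k
    * (qpoch (Cpower q ((1 + z) / 2)) q k / qpoch q q k ^ 3)); [field; auto|].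
  rewrite qpoch_inv_pow_pair by assumption. field. auto.
Qed.

(** * Splitting the factorials of even length *)

(** Uses the roots [q^(1/2)] of [q] and [q] of [q^2] in [qpoch_double_sqrt]. *)
Lemma qpoch_q_double (q : C) (k : nat) : q <> 0 ->
  qpoch q q (2 * k)
  = qpoch (Cpower q (1 / 2)) q k * qpoch (- Cpower q (1 / 2)) q k
    * (qpoch q q k * qpoch (- q) q k).
Proof.
  intros Hq. rewrite qpoch_double_sqrt.
  - now rewrite Cpower_half_sqr.
  - now rewrite Cpower_half_sqr.
Qed.

Lemma qpoch_q3_double (q : C) (k : nat) : q <> 0 ->
  qpoch (q ^ 3) q (2 * k)
  = qpoch (Cpower q (3 / 2)) q k * qpoch (- Cpower q (3 / 2)) q k
    * (qpoch (q ^ 2) q k * qpoch (- q ^ 2) q k).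
Proof.
  intros Hq. rewrite qpoch_double_sqrt; rewrite Cpower_3half_sqr by assumption.
  - reflexivity.
  - simpl. ring.
Qed.

(** The denominators of the three identities: [i = 0] gives [(qt;q)_(2k)] and
    [i = 1] gives [(q^3 t;q)_(2k)]. *)
Lemma qpoch_sqrt_double (q t : C) (i k : nat) :
  qpoch (q ^ S (2 * i) * t) q (2 * k)
  = qpoch (Csqrt (q ^ S (2 * i) * t)) q k
    * qpoch (- Csqrt (q ^ S (2 * i) * t)) q k
    * (qpoch (q ^ S i * Csqrt t) q k * qpoch (- (q ^ S i * Csqrt t)) q k).
Proof.
  rewrite qpoch_double_sqrt; rewrite Csqrt_sqr; [reflexivity|].
  transitivity (q ^ S i * q ^ S i * (Csqrt t * Csqrt t)); [ring|].
  rewrite Csqrt_sqr, !Cpow_S.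
  replace (2 * i)%nat with (i + i)%nat by lia. rewrite Cpow_add_r. ring.
Qed.

Lemma Cmult_neq_0_inv (a b : C) : a * b <> 0 -> a <> 0 /\ b <> 0.
Proof. intros H. split; intros E; apply H; rewrite E; ring. Qed.

Lemma Cinv_neq_0 (a : C) : a <> 0 -> / a <> 0.
Proof.
  intros Ha E. apply C1_nz. rewrite <- (Cinv_l a Ha), E. ring.
Qed.

Lemma Cmod_pow_mult_lt_1 (q t : C) (i : nat) :
  (Cmod q < 1)%R -> (Cmod t < 1)%R -> (Cmod (q ^ i * t) < 1)%R.
Proof.
  intros Hq Ht. rewrite Cmult_comm.
  eapply Rle_lt_trans; [now apply Cmod_mult_pow_le|exact Ht].
Qed.

(** Avoids estimating the square roots: the product of the four factors is
    [(q^(2i+1) t;q)_(2k)], which does not vanish. *)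
Lemma sqrt_factors_neq_0 (q t : C) (i k : nat) :
  (Cmod q < 1)%R -> (Cmod t < 1)%R ->
  qpoch (Csqrt (q ^ S (2 * i) * t)) q k <> 0
  /\ qpoch (- Csqrt (q ^ S (2 * i) * t)) q k <> 0
  /\ qpoch (q ^ S i * Csqrt t) q k <> 0
  /\ qpoch (- (q ^ S i * Csqrt t)) q k <> 0.
Proof.
  intros Hq Ht.
  assert (N : qpoch (q ^ S (2 * i) * t) q (2 * k) <> 0)
    by (apply qpoch_neq_0; [now apply Cmod_pow_mult_lt_1|exact Hq]).
  rewrite qpoch_sqrt_double in N.
  apply Cmult_neq_0_inv in N as [N1 N2].
  apply Cmult_neq_0_inv in N1 as [? ?].
  apply Cmult_neq_0_inv in N2 as [? ?]. auto.
Qed.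

Lemma sqrt_factors_neq_0_base (q t : C) (k : nat) :
  (Cmod q < 1)%R -> (Cmod t < 1)%R ->
  qpoch (Csqrt (q * t)) q k <> 0 /\ qpoch (- Csqrt (q * t)) q k <> 0
  /\ qpoch (q * Csqrt t) q k <> 0 /\ qpoch (- (q * Csqrt t)) q k <> 0.
Proof.
  intros Hq Ht. pose proof (sqrt_factors_neq_0 q t 0 k Hq Ht) as H.
  change (S (2 * 0)) with 1%nat in H. now rewrite !Cpow_1_r in H.
Qed.

Lemma qpoch_S_double (q t : C) (k : nat) :
  qpoch t q (S (2 * k))
  = (1 - t) * (qpoch (Csqrt (q * t)) q k * qpoch (- Csqrt (q * t)) q k
    * (qpoch (q * Csqrt t) q k * qpoch (- (q * Csqrt t)) q k)).
Proof.
  pose proof (qpoch_sqrt_double q t 0 k) as H.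
  change (S (2 * 0)) with 1%nat in H. rewrite !Cpow_1_r in H. rewrite <- H.
  change (S (2 * k)) with (1 + 2 * k)%nat. rewrite qpoch_add.
  simpl qpoch at 1. rewrite Cpow_1_r, (Cmult_comm t q). ring.
Qed.

(** * The three generating functions *)

Lemma generating_BatemanZ (q z t : C) :
  q <> 0 -> (Cmod q < 1)%R -> (Cmod t < 1)%R -> (Cmod (z * t) < 1)%R ->
  let a := [- q; Cpower q (1 / 2); - Cpower q (1 / 2); RtoC 0] in
  let b := [q; q * Csqrt t; - (q * Csqrt t); Csqrt (q * t); - Csqrt (q * t)] in
  phi_wd a b q (z * t) /\
  has_Csum (fun n => BatemanZ n z q * t ^ n)
    (1 / (1 - t) * phi a b q (z * t)).
Proof.
  intros Hq Hq1 Ht Hzt a b.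
  destruct (generating_function q t (fun k => sgnq q k * sgnq q k * z ^ k)
    (fun k => 1 * Cmod (z * t) ^ k)%R Hq1 Ht) as [L [HF HB]].
  - intros k.
    replace (sgnq q k * sgnq q k * z ^ k * t ^ k)
      with (sgnq q k * sgnq q k * (z * t) ^ k)
      by (rewrite Cpow_mult_l; ring).
    rewrite (Cmod_mult _ ((z * t) ^ k)), Cmod_pow, Cmod_mult.
    apply Rmult_le_compat_r; [apply pow_le, Cmod_ge_0|].
    pose proof (Cmod_sgnq_le q k Hq1). pose proof (Cmod_ge_0 (sgnq q k)). nra.
  - apply ex_series_geom_scal. split; [apply Cmod_ge_0|exact Hzt].
  - pose proof (one_minus_neq_0 t Ht) as N.
    destruct (phi_wd_sum a b q (z * t) (1 / (1 - t)) L _ HF Hq1)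
      as [Hwd HL].
    + intros k. destruct (sqrt_factors_neq_0_base q t k Hq1 Ht) as [? [? [? ?]]].
      unfold b. cbn [qpochs fold_right].
      repeat apply Cmult_neq_0; auto using C1_nz. now apply qpoch_neq_0.
    + unfold Cdiv. rewrite Cmult_1_l. now apply Cinv_neq_0.
    + intros k. destruct (sqrt_factors_neq_0_base q t k Hq1 Ht) as [? [? [? ?]]].
      pose proof (qpoch_neq_0 q q k Hq1 Hq1).
      pose proof (sgnq_neq_0 q k Hq).
      rewrite qpoch_q_double, qpoch_S_double by assumption.
      unfold phi_term, a, b. fold (sgnq q k).
      cbn [qpochs fold_right length Nat.add].
      rewrite qpoch_0, Cpow_mult_l. field. auto 10.
    + split; [exact Hwd|]. rewrite <- HL. revert HB. apply has_Csum_ext.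
      intros n. now rewrite BatemanZ_sum.
Qed.

Lemma generating_BatemanB (q z t : C) :
  q <> 0 -> (Cmod q < 1)%R -> (Cmod t < 1)%R ->
  let a := [- q; Cpower q (1 / 2); - Cpower q (1 / 2);
            Cpower q ((z + 1) / 2); RtoC 0] in
  let b := [q; Csqrt (q * t); - Csqrt (q * t); q * Csqrt t; - (q * Csqrt t)] in
  phi_wd a b q t /\
  has_Csum (fun n => BatemanB n z q * t ^ n) (1 / (1 - t) * phi a b q t).
Proof.
  intros Hq Hq1 Ht a b.
  destruct (generating_function q t
    (fun k => sgnq q k * qpoch (Cpower q ((1 + z) / 2)) q k)
    (fun k => exp (Cmod (Cpower q ((1 + z) / 2)) / (1 - Cmod q))
      * Cmod t ^ k)%R Hq1 Ht) as [L [HF HB]].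
  - intros k.
    rewrite !Cmod_mult, Cmod_pow.
    apply Rmult_le_compat_r; [apply pow_le, Cmod_ge_0|].
    rewrite <- (Rmult_1_l (exp _)).
    apply Rmult_le_compat; try apply Cmod_ge_0;
      [now apply Cmod_sgnq_le|now apply Cmod_qpoch_le].
  - apply ex_series_geom_scal. split; [apply Cmod_ge_0|exact Ht].
  - pose proof (one_minus_neq_0 t Ht) as N.
    destruct (phi_wd_sum a b q t (1 / (1 - t)) L _ HF Hq1)
      as [Hwd HL].
    + intros k. destruct (sqrt_factors_neq_0_base q t k Hq1 Ht) as [? [? [? ?]]].
      unfold b. cbn [qpochs fold_right].
      repeat apply Cmult_neq_0; auto using C1_nz. now apply qpoch_neq_0.
    + unfold Cdiv. rewrite Cmult_1_l. now apply Cinv_neq_0.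
    + intros k. destruct (sqrt_factors_neq_0_base q t k Hq1 Ht) as [? [? [? ?]]].
      pose proof (qpoch_neq_0 q q k Hq1 Hq1).
      pose proof (sgnq_neq_0 q k Hq).
      rewrite qpoch_q_double, qpoch_S_double by assumption.
      unfold phi_term, a, b. fold (sgnq q k).
      cbn [qpochs fold_right length Nat.add].
      rewrite qpoch_0, (Cplus_comm z 1). field. auto 10.
    + split; [exact Hwd|]. rewrite <- HL. revert HB. apply has_Csum_ext.
      intros n. now rewrite BatemanB_sum.
Qed.

(** The hypergeometric series is multiplied by [t], so its convergence cannot
    be read off from the generating function at [t = 0]; there it has a single
    nonzero term. *)
Lemma generating_BatemanB_diff (q z t : C) :
  q <> 0 -> (Cmod q < 1)%R -> (Cmod t < 1)%R ->
  let a := [- q ^ 2; Cpower q (3 / 2); - Cpower q (3 / 2);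
            Cpower q ((z + 1) / 2); RtoC 0] in
  let b := [q ^ 2; Csqrt (q ^ 3 * t); - Csqrt (q ^ 3 * t);
            q ^ 2 * Csqrt t; - (q ^ 2 * Csqrt t)] in
  phi_wd a b q (q * t) /\
  has_Csum (fun n => (BatemanB n (z - 2) q - BatemanB n z q) * t ^ n)
    (Cpower q ((z - 1) / 2) * (1 + q) * t / qpoch t q 3
     * phi a b q (q * t)).
Proof.
  intros Hq Hq1 Ht a b.
  set (a' := Cpower q ((z - 1) / 2)).
  assert (Ea' : Cpower q ((z + 1) / 2) = a' * q).
  { unfold a'. rewrite <- (Cpower_1_r q Hq) at 3. rewrite <- Cpower_add. f_equal.
    field. }
  set (v := fun k => sgnq q k * (qpoch a' q k - qpoch (a' * q) q k)).
  assert (vS : forall k, v (S k)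
    = a' * (1 - q ^ S k) * q ^ k * sgnq q k * qpoch (a' * q) q k).
  { intros k. unfold v. rewrite sgnq_S. cbn [qpoch].
    rewrite <- qpoch_shift. rewrite !Cpow_S. ring. }
  destruct (generating_function q t v
    (fun k => (exp (Cmod a' / (1 - Cmod q))
      + exp (Cmod (a' * q) / (1 - Cmod q))) * Cmod t ^ k)%R Hq1 Ht)
    as [L [HF HB]].
  { intros k. unfold v. rewrite !Cmod_mult, Cmod_pow.
    apply Rmult_le_compat_r; [apply pow_le, Cmod_ge_0|].
    rewrite <- (Rmult_1_l (_ + _)).
    apply Rmult_le_compat; try apply Cmod_ge_0; [now apply Cmod_sgnq_le|].
    eapply Rle_trans; [apply Cmod_triangle|]. rewrite Cmod_opp.
    rewrite <- Cmod_mult.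
    apply Rplus_le_compat; now apply Cmod_qpoch_le. }
  { apply ex_series_geom_scal. split; [apply Cmod_ge_0|exact Ht]. }
  assert (Hlhs : has_Csum
    (fun n => (BatemanB n (z - 2) q - BatemanB n z q) * t ^ n) L).
  { revert HB. apply has_Csum_ext. intros n. rewrite !BatemanB_sum by assumption.
    replace ((1 + (z - 2)) / 2) with ((z - 1) / 2) by (f_equal; ring).
    fold a'. rewrite (Cplus_comm 1 z), Ea', <- sum_n_Cminus. f_equal.
    apply sum_n_ext. intros k. unfold v.
    match goal with |- @eq _ ?a ?b => change (@eq C a b) end. ring. }
  assert (Nb : forall k, qpoch (q ^ 2) q k <> 0).
  { intros k. apply qpoch_neq_0; [|exact Hq1].
    rewrite <- (Cmult_1_r (q ^ 2)), Cpow_S, Cpow_1_r, Cmult_1_r, Cmod_mult.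
    pose proof (Cmod_ge_0 q). nra. }
  assert (Hb : forall k, qpochs b q k <> 0).
  { intros k. destruct (sqrt_factors_neq_0 q t 1 k Hq1 Ht) as [? [? [? ?]]].
    unfold b. cbn [qpochs fold_right].
    repeat apply Cmult_neq_0; auto using C1_nz. }
  pose proof (qpoch_neq_0 t q 3 Ht Hq1) as N3.
  assert (N1 : 1 - q <> 0) by now apply one_minus_neq_0.
  assert (HS := has_Csum_incr _ _ HF). cbv beta in HS.
  assert (E0 : v 0%nat = 0) by (unfold v; simpl; ring).
  rewrite E0, !Cmult_0_l in HS.
  replace (L - 0) with L in HS by ring.
  assert (Term : forall k, v (S k) * t ^ S k *
      (qpoch q q (2 * S k) / (qpoch q q (S k) ^ 3 * qpoch t q (S (2 * S k))))
    = a' * (1 + q) * t / qpoch t q 3 * phi_term a b q (q * t) k).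
  { intros k. rewrite vS.
    destruct (sqrt_factors_neq_0 q t 1 k Hq1 Ht) as [? [? [? ?]]].
    pose proof (qpoch_sqrt_double q t 1 k) as HD.
    change (S (2 * 1)) with 3%nat in *.
    replace (S (2 * S k)) with (3 + 2 * k)%nat by lia.
    replace (2 * S k)%nat with (2 + 2 * k)%nat by lia.
    rewrite (qpoch_add t), (qpoch_add q q 2).
    replace (t * q ^ 3) with (q ^ 3 * t) by ring.
    rewrite HD. replace (q * q ^ 2) with (q ^ 3) by (simpl; ring).
    rewrite qpoch_q3_double by assumption.
    assert (Q1 : qpoch q q (S k) = (1 - q) * qpoch (q ^ 2) q k).
    { change (S k) with (1 + k)%nat. rewrite qpoch_add, Cpow_1_r.
      replace (q * q) with (q ^ 2) by (simpl; ring). simpl. ring. }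
    pose proof (qpoch_neq_0 q q (S k) Hq1 Hq1) as NS.
    assert (Q2 : qpoch q q (S k) = qpoch q q k * (1 - q ^ S k)) by reflexivity.
    (* Two factors [(q;q)_(k+1)] are matched with [(q^2;q)_k], the third one with
       [(q;q)_k], whose extra factor cancels the one in [v (S k)]. *)
    replace (qpoch q q (S k) ^ 3) with
      (((1 - q) * qpoch (q ^ 2) q k) * ((1 - q) * qpoch (q ^ 2) q k)
        * (qpoch q q k * (1 - q ^ S k)))
      by (rewrite <- Q1, <- Q2; simpl; ring).
    rewrite Q2 in NS. apply Cmult_neq_0_inv in NS as [? ?].
    pose proof (sgnq_neq_0 q k Hq). pose proof (Nb k).
    replace (qpoch q q 2) with ((1 - q) * (1 - q) * (1 + q))
      by (simpl; ring).
    set (T := qpoch t q 3) in *.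
    set (y := q ^ S k) in *.
    unfold phi_term, a, b. fold (sgnq q k).
    cbn [qpochs fold_right length Nat.add].
    rewrite qpoch_0, Ea', Cpow_mult_l, (Cpow_S t).
    field. auto 12. }
  assert (HP : has_Csum
    (fun k => a' * (1 + q) * t / qpoch t q 3 * phi_term a b q (q * t) k) L)
    by (revert HS; apply has_Csum_ext; exact Term).
  destruct (Ceq_dec t 0) as [E|Nt].
  - replace L with (RtoC 0) in Hlhs.
    + split.
      * split; [intros k; split; [apply Hb|now apply qpoch_neq_0]|].
        eexists. apply (has_Csum_finite _ 0). intros k Hk.
        unfold phi_term. rewrite E, Cmult_0_r. destruct k; [lia|].
        unfold Cdiv. now rewrite (Cpow_S 0), !Cmult_0_l, Cmult_0_r.
      * replace (a' * (1 + q) * t / qpoch t q 3 * phi a b q (q * t))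
          with (RtoC 0); [exact Hlhs|].
        rewrite E. unfold Cdiv. ring.
    + transitivity (0 * L); [ring|].
      apply (has_Csum_unique _ _ _ (has_Csum_scal 0 _ _ HP)).
      revert HP. apply has_Csum_ext. intros k. rewrite E. unfold Cdiv. ring.
  - destruct (phi_wd_sum a b q (q * t) (a' * (1 + q) * t / qpoch t q 3) L _ HP Hq1
      Hb) as [Hwd HL].
    + assert (1 + q <> 0).
      { replace (1 + q) with (1 - - q) by ring. apply one_minus_neq_0.
        now rewrite Cmod_opp. }
      unfold Cdiv. repeat apply Cmult_neq_0; try assumption.
      * apply Cexp_neq_0.
      * now apply Cinv_neq_0.
    + reflexivity.
    + split; [exact Hwd|]. now rewrite <- HL.
Qed.

Theorem theorem3p1 (q z : C) (hq0 : (0 < Cmod q)%R) (hq1 : (Cmod q < 1)%R) :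
  exists delta : R, (0 < delta)%R /\
  forall t : C, (Cmod t < delta)%R ->
    (let a := [- q; Cpower q (1 / 2); - Cpower q (1 / 2); RtoC 0] in
     let b := [q; q * Csqrt t; - (q * Csqrt t); Csqrt (q * t); - Csqrt (q * t)] in
     phi_wd a b q (z * t) /\
     has_Csum (fun n => BatemanZ n z q * t ^ n)
       (1 / (1 - t) * phi a b q (z * t)))
    /\
    (let a := [- q; Cpower q (1 / 2); - Cpower q (1 / 2);
               Cpower q ((z + 1) / 2); RtoC 0] in
     let b := [q; Csqrt (q * t); - Csqrt (q * t); q * Csqrt t; - (q * Csqrt t)] in
     phi_wd a b q t /\
     has_Csum (fun n => BatemanB n z q * t ^ n)
       (1 / (1 - t) * phi a b q t))
    /\
    (let a := [- q ^ 2; Cpower q (3 / 2); - Cpower q (3 / 2);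
               Cpower q ((z + 1) / 2); RtoC 0] in
     let b := [q ^ 2; Csqrt (q ^ 3 * t); - Csqrt (q ^ 3 * t);
               q ^ 2 * Csqrt t; - (q ^ 2 * Csqrt t)] in
     phi_wd a b q (q * t) /\
     has_Csum (fun n => (BatemanB n (z - 2) q - BatemanB n z q) * t ^ n)
       (Cpower q ((z - 1) / 2) * (1 + q) * t / qpoch t q 3
        * phi a b q (q * t))).
Proof.
  assert (hq : q <> 0) by now apply Cmod_gt_0.
  pose proof (Cmod_ge_0 z) as Hz.
  (* Small enough for both [|t| < 1] and [|z t| < 1], so that [|z t|^k]
     dominates [u_k^2 (z t)^k] in the first identity. *)
  exists (/ (1 + Cmod z))%R. split; [apply Rinv_0_lt_compat; lra|].
  intros t Ht. pose proof (Cmod_ge_0 t) as Ht0.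
  assert (Ht1 : (Cmod t * (1 + Cmod z) < 1)%R).
  { pose proof (Rmult_lt_compat_r (1 + Cmod z) _ _ ltac:(lra) Ht) as H.
    now rewrite Rinv_l in H by lra. }
  assert (Cmod t < 1)%R by nra.
  split; [|split].
  - apply generating_BatemanZ; try assumption. rewrite Cmod_mult. nra.
  - now apply generating_BatemanB.
  - now apply generating_BatemanB_diff.
Qed.
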